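(* Let $(V,E)$ be a simple, finite, connected graph with maximum degree $\Delta$, let $\beta\in(0,1)$ with $\beta\Delta\le1$, and consider the hardcore model on $(V,E)$ with parameter $\beta$ (described in the context). Set $$\kappa_*=1-\beta(\Delta-1),\qquad \overline{\kappa_*}=\min\{\beta,\,1-\beta\Delta\}.$$ Let $\theta:(0,\infty)^2\to[0,\infty)$ be any weight function that is not identically $0$, symmetric, differentiable and concave. Then for all $\rho:\Omega\to(0,\infty)$ and $\psi:\Omega\to\mathbb{R}$, $$\mathscr{B}(\rho,\psi)\ \ge\ \Big(\frac{\kappa_*}{2}+M_\theta\,\overline{\kappa_*}\Big)\,\mathscr{A}(\rho,\psi).$$
   Context: **Hardcore model.** $x\sim y$ denotes adjacency in $(V,E)$ and $\bar N_x=\{x\}\cup\{y\in V:y\sim x\}$. $\Omega=\{\eta\in\{0,1\}^V:\eta_x\eta_y=0\text{ if }x\sim y\}$. Moves $G=\{\gamma_x^+,\gamma_x^-:x\in V\}$: $\gamma_x^{\pm}\eta=\eta\pm\delta_x$ if this lies in $\Omega$, and $\gamma_x^\pm\eta=\eta$ otherwise ($\delta_x$ is the indicator of $x$). Rates: $c(\eta,\gamma_x^+)=\beta\prod_{y\in\bar N_x}(1-\eta_y)$, $c(\eta,\gamma_x^-)=\eta_x$. Reversible measure: $m(\eta)=\frac1Z\prod_{x\in V}\beta^{\eta_x}$ for $\eta\in\Omega$, with $Z$ the normalizing constant. The generator is $\mathcal{L}\psi(\eta)=\sum_{\sigma\in G}c(\eta,\sigma)(\psi(\sigma\eta)-\psi(\eta))$,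 and $S=\{(\eta,\sigma)\in\Omega\times G:c(\eta,\sigma)>0\}$. $$M_\theta=\inf_{s,t>0:\ \theta(s,t)>0}\frac{\theta(s,s)+\theta(t,t)}{2\theta(s,t)}\in[0,1].$$ For $\rho:\Omega\to(0,\infty)$, $\psi:\Omega\to\mathbb{R}$: $$\mathscr{A}(\rho,\psi)=\tfrac12\sum_{(\eta,\sigma)\in S}m(\eta)c(\eta,\sigma)\,\theta(\rho(\eta),\rho(\sigma\eta))\,[\psi(\eta)-\psi(\sigma\eta)]^2,$$ $$\mathscr{C}(\rho,\psi)=\tfrac14\sum_{(\eta,\sigma)\in S}m(\eta)c(\eta,\sigma)\Big\{\partial_1\theta(\rho(\eta),\rho(\sigma\eta))\,\mathcal{L}\rho(\eta)+\partial_2\theta(\rho(\eta),\rho(\sigma\eta))\,\mathcal{L}\rho(\sigma\eta)\Big\}[\psi(\eta)-\psi(\sigma\eta)]^2,$$ $$\mathscr{D}(\rho,\psi)=\tfrac12\sum_{(\eta,\sigma)\in S}m(\eta)c(\eta,\sigma)\,\theta(\rho(\eta),\rho(\sigma\eta))(\psi(\eta)-\psi(\sigma\eta))(\mathcal{L}\psi(\eta)-\mathcal{L}\psi(\sigma\eta)),$$ and $\mathscr{B}=\mathscr{C}-\mathscr{D}$. *)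

(* Defs.v *)
From HB Require Import structures.
From mathcomp Require Import all_boot all_order all_algebra.
From mathcomp Require Import all_classical all_reals all_analysis.
Import Order.TTheory GRing.Theory Num.Theory.
Import numFieldNormedType.Exports.

Set Implicit Arguments.
Unset Strict Implicit.
Unset Printing Implicit Defensive.

Local Open Scope classical_set_scope.
Local Open Scope ring_scope.

Section Graph.
Variables (V : finType) (e : rel V).

Definition simple_graph := irreflexive e /\ symmetric e.

Definition connected_graph := forall x y : V, fingraph.connect e x y.

Definition max_degree : nat := \max_(x : V) #|[set y : V | e x y]%SET|.

Definition closed_nbhd (x : V) : {set V} := (x |: [set y : V | e y x])%SET.

End Graph.

Section Configurations.
Variables (V : finType) (e : rel V).

Definition independent (eta : {ffun V -> bool}) : bool :=
  [forall x, forall y, e x y ==> ~~ (eta x && eta y)].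

Record config := Config {
  config_val :> {ffun V -> bool};
  config_independent : independent config_val }.

HB.instance Definition _ := [isSub for config_val].
HB.instance Definition _ := [Finite of config by <:].

(* (x, true) stands for gamma_x^+ and (x, false) for gamma_x^-; the
   corresponding self-maps of [config] are pairwise distinct, so sums over
   [move] are sums over the set G of maps. *)
Definition move := (V * bool)%type.

(* Setting the value at x is eta +- delta_x when the latter is {0,1}-valued
   and is eta otherwise; [insubd eta] returns eta if the result is not
   independent. *)
Definition apply_move (g : move) (eta : config) : config :=
  insubd eta [ffun y => if y == g.1 then g.2 else eta y].

End Configurations.

Arguments move : clear implicits.

Section Hardcore.
Variables (R : realType) (V : finType) (e : rel V) (beta : R).

Local Notation Omega := (config e).
Local Notation G := (move V).

Definition rate (eta : Omega) (g : G) : R :=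
  if g.2 then beta * \prod_(y in closed_nbhd e g.1) (1 - (eta y)%:R)
  else (eta g.1)%:R.

Definition weight (eta : Omega) : R := \prod_(x : V) beta ^+ eta x.

Definition partition_function : R := \sum_(eta : Omega) weight eta.

Definition hardcore_measure (eta : Omega) : R :=
  partition_function^-1 * weight eta.

Definition generator (psi : Omega -> R) (eta : Omega) : R :=
  \sum_(g : G) rate eta g * (psi (apply_move g eta) - psi eta).

Variable theta : R -> R -> R.

Definition partial1 (s t : R) : R := derive1 (fun u : R => theta u t) s.
Definition partial2 (s t : R) : R := derive1 (fun u : R => theta s u) t.

Definition Afun (rho psi : Omega -> R) : R :=
  2^-1 * \sum_(p : Omega * G | 0 < rate p.1 p.2)
    let eta := p.1 in let eta' := apply_move p.2 p.1 in
    hardcore_measure eta * rate eta p.2 * theta (rho eta) (rho eta') *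
    (psi eta - psi eta') ^+ 2.

Definition Cfun (rho psi : Omega -> R) : R :=
  4^-1 * \sum_(p : Omega * G | 0 < rate p.1 p.2)
    let eta := p.1 in let eta' := apply_move p.2 p.1 in
    hardcore_measure eta * rate eta p.2 *
    (partial1 (rho eta) (rho eta') * generator rho eta +
     partial2 (rho eta) (rho eta') * generator rho eta') *
    (psi eta - psi eta') ^+ 2.

Definition Dfun (rho psi : Omega -> R) : R :=
  2^-1 * \sum_(p : Omega * G | 0 < rate p.1 p.2)
    let eta := p.1 in let eta' := apply_move p.2 p.1 in
    hardcore_measure eta * rate eta p.2 * theta (rho eta) (rho eta') *
    (psi eta - psi eta') * (generator psi eta - generator psi eta').

Definition Bfun (rho psi : Omega -> R) : R := Cfun rho psi - Dfun rho psi.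

End Hardcore.

Section WeightFunction.
Variables (R : realType) (theta : R -> R -> R).

Definition quadrant : set (R^o * R^o) := [set p | 0 < p.1 /\ 0 < p.2].

(* Only the values of theta on the open quadrant are constrained. *)
Record weight_function : Prop := WeightFunction {
  theta_ge0 : forall s t : R, 0 < s -> 0 < t -> 0 <= theta s t;
  theta_neq0 : exists s t : R, [/\ 0 < s, 0 < t & theta s t != 0];
  theta_sym : forall s t : R, 0 < s -> 0 < t -> theta s t = theta t s;
  theta_diff : forall s t : R, 0 < s -> 0 < t ->
    differentiable (fun p : R^o * R^o => theta p.1 p.2 : R^o) ((s : R^o), (t : R^o));
  theta_concave :
    convex_function (E := (R^o * R^o)%type) quadrant
      (fun p => - theta p.1 p.2) }.

(* For a weight function this infimum is over a nonempty set of nonnegative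
   reals, so [inf] is the genuine one. *)
Definition M_theta : R :=
  inf [set r | exists s t : R, [/\ 0 < s, 0 < t, 0 < theta s t &
         r = (theta s s + theta t t) / (2 * theta s t)]].

End WeightFunction.

(* Main.v *)
(* Each unoriented edge {eta, xi = eta + delta_x} contributes L u eta + L v xi, where
   u and v are affine in rho and psi.  Couple the moves from eta and xi: insert or
   delete a common vertex y; insert a neighbour y of x in eta while deleting x in xi;
   with the remaining rates, beta and 1 - beta k (k <= Delta the number of neighbours
   of x that can be inserted), merge at xi or at eta.  A coupled move to (a, b)
   contributes, by concavity of theta and 2pq <= p^2 + q^2, at least
     (theta(a, b) (psi eta - psi xi)^2 - theta(eta, xi) (psi a - psi b)^2) / 2.
   Summed against beta m(eta), these bounds cancel for the common moves (inserting y
   is reversed by deleting y) and for the swaps (exchange x and y).  When a = b the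
   step 2pq <= p^2 + q^2 is not needed, which leaves an extra half of
   theta(eta, xi) (psi eta - psi xi)^2; this gives the kappa / 2, and
   theta(a, a) gives the M_theta part. *)
Require Import Defs.
From mathcomp Require Import all_boot all_order all_algebra.
From mathcomp Require Import all_classical all_reals all_analysis.
From mathcomp Require Import ring lra.
Import Order.TTheory GRing.Theory Num.Theory.
Import numFieldNormedType.Exports.
Local Open Scope classical_set_scope.
Set Implicit Arguments.
Unset Strict Implicit.
Local Open Scope ring_scope.

(** * Tangent bounds for the concave weight function and the constant [M_theta] *)

Section Concave.
Variables (R : realType) (theta : R -> R -> R).
Hypothesis theta_weight : weight_function theta.

Lemma concave_segment (s t s' t' h : R) : 0 < s -> 0 < t -> 0 < s' -> 0 < t' ->
  0 < h -> h < 1 ->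
  h * (theta s' t' - theta s t) <=
  theta (h * (s' - s) + s) (h * (t' - t) + t) - theta s t.
Proof.
move=> s0 t0 s'0 t'0 h0 h1.
have hh : Itv.spec (@Itv.num_sem R) (Itv.Real `[0%Z, 1%Z]) h.
  by rewrite /= /Itv.num_sem/= realE (ltW h0)/= in_itv/= (ltW h0) (ltW h1).
have /= := theta_concave theta_weight (Itv.mk hh)
  (mem_set (conj s'0 t'0 : (quadrant (R := R)) (s', t')))
  (mem_set (conj s0 t0 : (quadrant (R := R)) (s, t))).
rewrite convRE /conv/= /GRing.scale/= /unstable.onem.
have -> : h * s' + (1 - h) * s = h * (s' - s) + s by ring.
have -> : h * t' + (1 - h) * t = h * (t' - t) + t by ring.
lra.
Qed.

Lemma partial1E (s t : R) : 0 < s -> 0 < t ->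
  partial1 theta s t =
  'd (fun p : R^o * R^o => theta p.1 p.2 : R^o) ((s : R^o), (t : R^o)) ((1 : R^o), (0 : R^o)).
Proof.
move=> s0 t0; rewrite -(deriveE _ (theta_diff theta_weight s0 t0)).
rewrite /partial1 /derive1 /derive.
by under [in RHS]eq_fun do rewrite /= /GRing.scale/= mulr1 mulr0 add0r.
Qed.

Lemma partial2E (s t : R) : 0 < s -> 0 < t ->
  partial2 theta s t =
  'd (fun p : R^o * R^o => theta p.1 p.2 : R^o) ((s : R^o), (t : R^o)) ((0 : R^o), (1 : R^o)).
Proof.
move=> s0 t0; rewrite -(deriveE _ (theta_diff theta_weight s0 t0)).
rewrite /partial2 /derive1 /derive.
by under [in RHS]eq_fun do rewrite /= /GRing.scale/= mulr1 mulr0 add0r.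
Qed.

(** A concave function lies below its tangent plane: the right-hand side is the derivative along
    [(s' - s, t' - t)], a limit of difference quotients that [concave_segment] bounds below by the
    left-hand side. *)
Lemma concave_tangent (s t s' t' : R) : 0 < s -> 0 < t -> 0 < s' -> 0 < t' ->
  theta s' t' - theta s t <=
  partial1 theta s t * (s' - s) + partial2 theta s t * (t' - t).
Proof.
move=> s0 t0 s'0 t'0; rewrite partial1E// partial2E//.
have df := theta_diff theta_weight s0 t0.
set f := (fun p : R^o * R^o => theta p.1 p.2 : R^o) in df *.
set v : R^o * R^o := (s' - s, t' - t).
have -> : 'd f ((s : R^o), (t : R^o)) ((1 : R^o), (0 : R^o)) * (s' - s) +
    'd f ((s : R^o), (t : R^o)) ((0 : R^o), (1 : R^o)) * (t' - t) =
    'D_v f ((s : R^o), (t : R^o)).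
  rewrite deriveE//.
  have -> : v = (s' - s) *: ((1 : R^o), (0 : R^o)) + (t' - t) *: ((0 : R^o), (1 : R^o)).
    by congr pair; rewrite /= /GRing.scale/= ?mulr1 ?mulr0 ?addr0 ?add0r.
  by rewrite linearD !linearZ /GRing.scale/= mulrC [X in _ + X]mulrC.
have dv : derivable f ((s : R^o), (t : R^o)) v by exact: diff_derivable.
(* Only small positive [h] keep the point on the segment, so the limit is taken from the right. *)
rewrite /derive cvg_at_rightE//.
apply: limr_ge.
  by apply/cvg_ex; exists (lim (h^-1 *: ((f \o shift ((s : R^o), (t : R^o))) (h *: v) -
     f ((s : R^o), (t : R^o))) @[h --> 0^'])); apply: cvg_dnbhs_at_right; exact: dv.
near=> h.
have h0 : 0 < h by near: h; exact: nbhs_right_gt.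
have h1 : h < 1 by near: h; apply: nbhs_right_lt.
rewrite /GRing.scale/= ler_pdivlMl//.
exact: concave_segment.
Unshelve. all: by end_near.
Qed.

(* The coefficients are averaged over both orientations, as they occur in [Cfun] after
   grouping by edges. *)
Lemma concave_tangent_sym (s t s' t' : R) : 0 < s -> 0 < t -> 0 < s' -> 0 < t' ->
  theta s' t' - theta s t <=
  (partial1 theta s t + partial2 theta t s) / 2 * (s' - s) +
  (partial2 theta s t + partial1 theta t s) / 2 * (t' - t).
Proof.
move=> s0 t0 s'0 t'0.
have := concave_tangent s0 t0 s'0 t'0.
have := concave_tangent t0 s0 t'0 s'0.
rewrite (theta_sym theta_weight t0 s0) (theta_sym theta_weight t'0 s'0).
lra.
Qed.

Lemma M_theta_le (s t : R) : 0 < s -> 0 < t ->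
  2 * M_theta theta * theta s t <= theta s s + theta t t.
Proof.
move=> s0 t0.
have th0 := theta_ge0 theta_weight.
(* When [theta s t = 0] the pair is excluded from the infimum, but the bound reduces to
   nonnegativity of [theta]. *)
have := th0 _ _ s0 t0; rewrite le_eqVlt => /predU1P[<-|st0].
  by rewrite mulr0 addr_ge0 ?th0.
suff : M_theta theta <= (theta s s + theta t t) / (2 * theta s t).
  by rewrite ler_pdivlMr ?mulr_gt0// mulrCA mulrA.
apply: ge_inf; last by exists s, t.
exists 0 => _ [a [b [a0 b0 ab0 ->]]].
by rewrite divr_ge0 ?addr_ge0 ?th0 ?mulr_ge0 ?ltW.
Qed.
End Concave.

(** * Insertions and deletions of vertices, and how they commute *)

Section ConfigMoves.
Variables (V : finType) (e : rel V).
Implicit Types (eta xi : config e) (x y z : V).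

Definition free eta x := [forall y in closed_nbhd e x, ~~ eta y].
Definition ins x eta : config e := apply_move (x, true) eta.
Definition del x eta : config e := apply_move (x, false) eta.

Lemma config_eqP eta xi : (forall z, eta z = xi z) -> eta = xi.
Proof. by move=> eq_val; apply/val_inj/ffunP. Qed.

Lemma config_edge eta x y : e x y -> ~~ (eta x && eta y).
Proof.
by move=> exy; move/forallP: (config_independent eta) => /(_ x)/forallP/(_ y)/implyP; exact.
Qed.

Lemma freeP eta x :
  reflect (eta x = false /\ forall y, e y x -> eta y = false) (free eta x).
Proof.
apply: (iffP forall_inP) => [fr | [ex fr] y].
  split=> [|y eyx]; apply/negbTE/fr; by rewrite !inE ?eqxx// eyx orbT.
by rewrite !inE => /orP[/eqP->|/fr->//]; rewrite ex.
Qed.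

Hypothesis e_simple : simple_graph e.

Lemma insE eta x z : free eta x -> ins x eta z = (z == x) || eta z.
Proof.
have [irr sym] := e_simple.
move=> /freeP[ex fr]; rewrite /ins /apply_move /=.
have ind : independent e [ffun y => if y == x then true else eta y].
  apply/forallP => a; apply/forallP => b; apply/implyP => eab; rewrite !ffunE.
  case: (altP (a =P x)) eab => [->|ax] eab.
    case: (altP (b =P x)) eab => [->|bx eab]; first by rewrite irr.
    by rewrite fr// sym.
  case: (altP (b =P x)) eab => [-> eab|bx eab]; first by rewrite fr.
  exact: config_edge.
by rewrite insubdK// ffunE; case: eqP.
Qed.

Lemma delE eta x z : del x eta z = (z != x) && eta z.
Proof.
rewrite /del /apply_move /=.
have ind : independent e [ffun y => if y == x then false else eta y].
  apply/forallP => a; apply/forallP => b; apply/implyP => eab; rewrite !ffunE.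
  case: (altP (a =P x)) => // ax; case: (altP (b =P x)) => bx; first by rewrite andbF.
  exact: config_edge.
by rewrite insubdK// ffunE; case: eqP.
Qed.

Lemma insK eta x : free eta x -> del x (ins x eta) = eta.
Proof.
move=> fr; apply: config_eqP => z; rewrite delE insE//.
by case: eqP => [->|]//=; case/freeP: fr => ->.
Qed.

Lemma free_del eta x : eta x -> free (del x eta) x.
Proof.
move=> ex; apply/freeP; split=> [|y eyx]; rewrite delE ?eqxx//.
by have := config_edge eta eyx; rewrite ex andbT => /negbTE->; rewrite andbF.
Qed.

Lemma delK eta x : eta x -> ins x (del x eta) = eta.
Proof.
move=> ex; apply: config_eqP => z; rewrite insE ?free_del// delE.
by case: eqP => [->|]//=.
Qed.

Lemma free_ins eta x y : free eta x ->
  free (ins x eta) y = [&& free eta y, y != x & ~~ e x y].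
Proof.
move=> fr; apply/freeP/and3P => [[ey fry]|[/freeP[ey fry] yx exy]].
  have yx : y != x by apply: contraFN ey => /eqP->; rewrite insE// eqxx.
  split=> //; last by apply/negP => /fry; rewrite insE// eqxx.
  apply/freeP; split=> [|z /fry]; last by rewrite insE// => /norP[_ /negbTE].
  by move: ey; rewrite insE// => /norP[_ /negbTE].
rewrite insE// (negbTE yx) ey; split=> // z ezy; rewrite insE// fry// orbF.
by apply: contraNF exy => /eqP<-.
Qed.

Lemma ins_insC eta x y : free eta x -> free (ins x eta) y ->
  ins y (ins x eta) = ins x (ins y eta).
Proof.
move=> frx fry; have := fry; rewrite free_ins// => /and3P[fy yx exy].
have frx' : free (ins y eta) x.
  by rewrite free_ins// frx eq_sym yx e_simple.2.
by apply: config_eqP => z; rewrite !insE// orbCA.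
Qed.

(** Both sides say that [x] and [y] are free in [eta], distinct and nonadjacent. *)
Lemma free_insC eta x y :
  free eta x && free (ins x eta) y = free eta y && free (ins y eta) x.
Proof.
apply/andP/andP=> -[fr]; rewrite free_ins// => /and3P[fr' ne nexy].
  by rewrite free_ins// fr eq_sym ne e_simple.2.
by rewrite free_ins// fr eq_sym ne e_simple.2.
Qed.

Lemma ins_delC eta x y : free eta x -> eta y -> ins x (del y eta) = del y (ins x eta).
Proof.
move=> frx ey; have [ex frx'] := freeP _ _ frx.
have frdx : free (del y eta) x.
  by apply/freeP; rewrite delE ex andbF; split=> // z /frx'; rewrite delE => ->; rewrite andbF.
apply: config_eqP => z; rewrite insE// !delE insE//.
case: (altP (z =P x)) => //= ->; rewrite andbT.
by apply/esym; apply: contraFneq ex => ->.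
Qed.

(** [ins x] is a bijection from the configurations free at [x] onto those containing [x], with
    inverse [del x]. *)
Lemma ins_reindex (T : nmodType) x (P : pred (config e)) (F : config e -> T) :
  \sum_(eta : config e | eta x && P eta) F eta =
  \sum_(eta | free eta x && P (ins x eta)) F (ins x eta).
Proof.
rewrite (reindex_onto (ins x) (del x)) /=; last by move=> eta /andP[ex _]; exact: delK.
apply: eq_bigl => eta; apply/idP/idP=> [/andP[/andP[ex Pe] /eqP dk]|/andP[fr ->]].
  by rewrite Pe -dk free_del.
by rewrite insK// eqxx insE// eqxx.
Qed.

(** * Rates, the reversible measure and sums over edges *)

Variables (R : realType) (beta : R).
Hypothesis beta_gt0 : 0 < beta.

Lemma rate_ins eta x : rate beta eta (x, true) = if free eta x then beta else 0.
Proof.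
rewrite /rate/=; case: ifPn => [/freeP[ex fr]|].
  rewrite big1 ?mulr1// => y; rewrite !inE => /orP[/eqP->|/fr->]; rewrite ?ex subr0//.
rewrite negb_forall_in => /exists_inP[y yN]; rewrite negbK => ey.
by rewrite (bigD1 y)//= ey subrr mul0r mulr0.
Qed.

Lemma rate_gt0 eta g : (0 < rate beta eta g) = (if g.2 then free eta g.1 else eta g.1).
Proof.
case: g => x [|]; first by rewrite rate_ins; case: ifP; rewrite ?ltxx ?beta_gt0.
by rewrite /rate/= ltr0n lt0b.
Qed.

Lemma weight_ins eta x : free eta x -> weight beta (ins x eta) = beta * weight beta eta.
Proof.
move=> fr; have [ex _] := freeP _ _ fr.
rewrite /weight (bigD1 x)// [X in _ = _ * X](bigD1 x)//= insE// eqxx ex expr1 mul1r.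
by congr (_ * _); apply: eq_bigr => y yx; rewrite insE// (negbTE yx).
Qed.

Lemma measure_ins eta x : free eta x ->
  hardcore_measure beta (ins x eta) = beta * hardcore_measure beta eta.
Proof. by move=> fr; rewrite /hardcore_measure weight_ins// mulrCA. Qed.

Lemma measure_ge0 eta : 0 <= hardcore_measure beta eta.
Proof.
have wge0 xi : 0 <= weight beta xi by apply: prodr_ge0 => y _; exact/exprn_ge0/ltW.
by rewrite mulr_ge0// invr_ge0 sumr_ge0.
Qed.

Lemma sum_moves (T : nmodType) (F : V * bool -> T) :
  \sum_g F g = \sum_x (F (x, true) + F (x, false)).
Proof.
rewrite (eq_bigr (fun g => F (g.1, g.2))); last by case.
by rewrite -(pair_bigA _ (fun x b => F (x, b)))/=; apply: eq_bigr => x _; rewrite big_bool.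
Qed.

(* Detailed balance: both orientations of {eta, eta + delta_x} have weight beta m(eta). *)
Lemma sum_edges (F : config e -> config e -> R) :
  \sum_(p : config e * move V | 0 < rate beta p.1 p.2)
    hardcore_measure beta p.1 * rate beta p.1 p.2 * F p.1 (apply_move p.2 p.1) =
  \sum_x \sum_(eta | free eta x)
    beta * hardcore_measure beta eta * (F eta (ins x eta) + F (ins x eta) eta).
Proof.
rewrite (eq_bigl (fun p : config e * move V =>
  predT p.1 && (0 < rate beta p.1 p.2))); last by case.
rewrite -(pair_big_dep predT (fun eta g => 0 < rate beta eta g)
  (fun eta g => hardcore_measure beta eta * rate beta eta g * F eta (apply_move g eta)))/=.
under eq_bigr do rewrite big_mkcond sum_moves.
rewrite exchange_big/=; apply: eq_bigr => x _.
rewrite big_split/= -!big_mkcond/=.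
under eq_bigl do rewrite rate_gt0 /=.
under [X in _ + X]eq_bigl do rewrite rate_gt0 /=.
rewrite [X in _ + X](eq_bigl (fun eta => eta x && predT eta)); last by move=> eta; rewrite andbT.
rewrite (ins_reindex _ predT).
under [X in _ + X]eq_bigl do rewrite andbT.
rewrite -big_split/=; apply: eq_bigr => eta fr.
rewrite rate_ins fr /rate/= insE// eqxx mulr1 measure_ins//.
by rewrite -/(del x (ins x eta)) insK// -/(ins x eta); ring.
Qed.

(** * The generator and its coupling along an edge *)

Lemma generatorE (f : config e -> R) eta :
  generator beta f eta = \sum_(x | free eta x) beta * (f (ins x eta) - f eta) +
     \sum_(x | eta x) (f (del x eta) - f eta).
Proof.
rewrite /generator sum_moves big_split/=; congr (_ + _).
  rewrite [RHS]big_mkcond; apply: eq_bigr => x _; rewrite rate_ins.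
  by case: ifP; rewrite ?mul0r.
rewrite [RHS]big_mkcond; apply: eq_bigr => x _; rewrite /rate/=.
by case: (eta x); rewrite ?mul1r ?mul0r.
Qed.


(** Bounds the number [k] of swaps, so that the leftover rate [1 - beta * k] is nonnegative once
    [beta * Delta <= 1]. *)
Lemma neighbours_le_max_degree eta x :
  (\sum_(y | e x y && free eta y) 1 <= max_degree e)%N.
Proof.
rewrite sum1_card.
apply: leq_trans (leq_bigmax (F := fun x => #|[set y | e x y]|%SET) x).
by apply/subset_leq_card/fintype.subsetP => y; rewrite !inE => /andP[].
Qed.

Lemma generatorD (a b : R) (f g : config e -> R) eta :
  generator beta (fun c => a * f c + b * g c) eta =
  a * generator beta f eta + b * generator beta g eta.
Proof.
rewrite /generator !mulr_sumr -big_split/=; apply: eq_bigr => p _; ring.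
Qed.

(** The terms are, in order: common insertions, common deletions, swaps, merging at [xi] and merging
    at [eta]. Deleting [x] from [xi] has rate 1, of which each swap takes [beta]. *)
Lemma generator_coupling (u v : config e -> R) eta x : free eta x ->
  let xi := ins x eta in let w := u eta + v xi in
  generator beta u eta + generator beta v xi =
  beta * (\sum_(y | free xi y) (u (ins y eta) + v (ins y xi) - w)) +
  \sum_(y | eta y) (u (del y eta) + v (del y xi) - w) +
  beta * (\sum_(y | e x y && free eta y) (u (ins y eta) + v eta - w)) +
  beta * (u xi + v xi - w) +
  (1 - beta * (\sum_(y | e x y && free eta y) 1)) * (u eta + v eta - w).
Proof.
move=> fr xi w; have [ex _] := freeP _ _ fr.
(* Insertions from [eta] split into [x] itself, the neighbours of [x], and the vertices still free
   in [xi]; deletions from [xi] split into [x] and the vertices of [eta]. *)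
rewrite !generatorE (bigD1 x fr)/=.
rewrite (bigID (fun y => e x y))/=.
have xix : xi x by rewrite insE// eqxx.
rewrite (bigD1 x xix)/= insK//.
under [X in _ + (_ + (_ + X))]eq_bigl => y.
  have -> : xi y && (y != x) = eta y.
    by rewrite insE//; case: eqP => [->|]; rewrite ?ex ?andbT.
  over.
under [X in (_ + (X + _) + _)]eq_bigl => y.
  have -> : free eta y && (y != x) && e x y = e x y && free eta y.
    rewrite andbC; case exy: (e x y) => //=.
    by case: eqP exy => [->|]; rewrite ?e_simple.1 ?andbT.
  over.
under [X in (_ + (_ + X) + _)]eq_bigl => y.
  have -> : free eta y && (y != x) && ~~ e x y = free xi y by rewrite free_ins// andbA.
  over.
(* Each swap contributes the same [v eta - v xi]; these copies cancel the [- beta * k] of the last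
   rate. *)
have -> : \sum_(y | e x y && free eta y) (u (ins y eta) + v eta - w) =
  \sum_(y | e x y && free eta y) (u (ins y eta) - u eta) +
  (\sum_(y | e x y && free eta y) 1) * (v eta - v xi).
  by rewrite mulr_suml -big_split/=; apply: eq_bigr => y _; rewrite /w; ring.
have -> : \sum_(y | free xi y) (u (ins y eta) + v (ins y xi) - w) =
  \sum_(y | free xi y) (u (ins y eta) - u eta) + \sum_(y | free xi y) (v (ins y xi) - v xi).
  by rewrite -big_split/=; apply: eq_bigr => y _; rewrite /w; ring.
have -> : \sum_(y | eta y) (u (del y eta) + v (del y xi) - w) =
  \sum_(y | eta y) (u (del y eta) - u eta) + \sum_(y | eta y) (v (del y xi) - v xi).
  by rewrite -big_split/=; apply: eq_bigr => y _; rewrite /w; ring.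
rewrite -!mulr_sumr /w -/xi; ring.
Qed.

Lemma sum_antisym (I : finType) (G : I -> I -> R) :
  (forall i j, G i j = - G j i) -> \sum_i \sum_j G i j = 0.
Proof.
move=> anti; set S := \sum_i _.
suff : S = - S by lra.
rewrite {1}/S exchange_big -sumrN; apply: eq_bigr => i _.
by rewrite -sumrN; apply: eq_bigr => j _.
Qed.

(** * Cancellation of the exchange terms over all edges *)

Section Cancellation.
Variables T W : config e -> config e -> R.
Hypotheses (T_sym : forall c d, T c d = T d c) (W_sym : forall c d, W c d = W d c).

(** Twice the lower bound for a coupled move from [p] to [q]; its antisymmetry in [p] and [q] drives
    every cancellation. *)
Definition exchange_term (p q : config e * config e) : R :=
  T q.1 q.2 * W p.1 p.2 - T p.1 p.2 * W q.1 q.2.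

Definition common_ins eta x : R := \sum_(y | free (ins x eta) y)
  exchange_term (eta, ins x eta) (ins y eta, ins y (ins x eta)).
Definition common_del eta x : R := \sum_(y | eta y)
  exchange_term (eta, ins x eta) (del y eta, del y (ins x eta)).
(** The target's second component is [eta] because [x] is deleted from [ins x eta]. *)
Definition swap eta x : R := \sum_(y | e x y && free eta y)
  exchange_term (eta, ins x eta) (ins y eta, eta).

Local Notation m := (hardcore_measure beta).

(** For fixed [eta] the swap goes from the edge of [x] to the reversed edge of [y]; as [T] and [W]
    are symmetric, exchanging [x] and [y] changes the sign. *)
Lemma sum_swap : \sum_x \sum_(eta | free eta x) m eta * swap eta x = 0.
Proof.
under eq_bigr do rewrite big_mkcond.
rewrite exchange_big/= big1// => eta _.
rewrite -[RHS](sum_antisym (G := fun x y => if [&& free eta x, e x y & free eta y] then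
   m eta * exchange_term (eta, ins x eta) (ins y eta, eta) else 0)).
  apply: eq_bigr => x _; case: ifP => fr /=; last by rewrite big1.
  by rewrite mulr_sumr big_mkcond.
move=> x y.
have -> : [&& free eta x, e x y & free eta y] = [&& free eta y, e y x & free eta x].
  by rewrite (e_simple.2 x) andbC -andbA andbCA.
case: ifP => _; last by rewrite oppr0.
rewrite /exchange_term /= (T_sym (ins y eta)) (W_sym (ins y eta))
  (T_sym (ins x eta)) (W_sym (ins x eta)).
ring.
Qed.

(* Insertion of y at rate beta is the reversal of its deletion at rate 1. *)
Lemma sum_common :
  \sum_x \sum_(eta | free eta x) m eta * (beta * common_ins eta x + common_del eta x) = 0.
Proof.
rewrite big1// => x _.
under eq_bigr do rewrite mulrDr.
rewrite big_split/=; apply/eqP; rewrite addr_eq0 -sumrN; apply/eqP.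
pose I eta y := m eta * beta * exchange_term (eta, ins x eta) (ins y eta, ins y (ins x eta)).
pose J eta y := - (m eta * exchange_term (eta, ins x eta) (del y eta, del y (ins x eta))).
transitivity (\sum_y \sum_(eta | free eta x && free (ins x eta) y) I eta y).
  under [RHS]eq_bigr do rewrite big_mkcondr/= big_mkcond.
  rewrite exchange_big/= [LHS]big_mkcond; apply: eq_bigr => eta _.
  case: ifP => _; last by rewrite big1.
  by rewrite -big_mkcond /common_ins mulrA mulr_sumr.
transitivity (\sum_y \sum_(eta : config e | free eta x && eta y) J eta y); last first.
  under [LHS]eq_bigr do rewrite big_mkcondr/= big_mkcond.
  rewrite exchange_big/= [RHS]big_mkcond; apply: eq_bigr => eta _.
  case: ifP => _; last by rewrite big1.
  by rewrite -big_mkcond /common_del mulr_sumr sumrN.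
apply: eq_bigr => y _; under [RHS]eq_bigl do rewrite andbC.
(* Replacing [eta] by [ins y eta] turns deletions of [y] into insertions: the measure supplies the
   factor [beta], and exchanging the two pairs absorbs the sign in [J]. *)
rewrite (ins_reindex _ (fun eta => free eta x)).
apply: eq_big => eta; first by rewrite free_insC.
move=> /andP[frx frxy].
have /andP[fry fryx] : free eta y && free (ins y eta) x by rewrite -free_insC frx.
have yy : ins y eta y by rewrite insE// eqxx.
rewrite /I /J -(ins_delC fryx yy) insK// measure_ins// (ins_insC frx frxy) /exchange_term/=.
ring.
Qed.

End Cancellation.


(** * The inequality on a single edge *)

Section EdgeInequality.
Variables (theta : R -> R -> R) (rho psi : config e -> R).
Hypotheses (theta_weight : weight_function theta) (rho_gt0 : forall eta, 0 < rho eta).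
Hypothesis beta_max_degree : beta * (max_degree e)%:R <= 1.

Let T c d := theta (rho c) (rho d).
Let W c d := (psi c - psi d) ^+ 2.

(** Up to the factor [beta * m(eta)], the right-hand side is the share of this edge in B - K A, and
    the left-hand side consists of exchange terms that sum to zero over all edges. *)
Lemma edge_inequality eta x (xi := ins x eta)
    (Lr := generator beta rho) (Lp := generator beta psi)
    (K := (1 - beta * ((max_degree e)%:R - 1)) / 2 +
      M_theta theta * Num.min beta (1 - beta * (max_degree e)%:R)) : free eta x ->
  2^-1 * (beta * common_ins T W eta x + common_del T W eta x) + 2^-1 * (beta * swap T W eta x) <=
  ((partial1 theta (rho eta) (rho xi) + partial2 theta (rho xi) (rho eta)) / 2 * Lr eta +
   (partial2 theta (rho eta) (rho xi) + partial1 theta (rho xi) (rho eta)) / 2 * Lr xi) *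
    W eta xi / 2 -
  T eta xi * (psi eta - psi xi) * (Lp eta - Lp xi) - K * T eta xi * W eta xi.
Proof.
move=> fr.
set p1 := (_ + _) / 2; set p2 := (_ + _) / 2.
set t := T eta xi; set d := psi eta - psi xi; set w := W eta xi.
have w0 : 0 <= w by exact: sqr_ge0.
have t0 : 0 <= t by exact: (theta_ge0 theta_weight).
(* The coefficients of the edge are frozen as constants, so linearity moves them inside the
   generator. *)
pose u c := p1 * w / 2 * rho c + - (t * d) * psi c.
pose v c := p2 * w / 2 * rho c + t * d * psi c.
have -> : (p1 * Lr eta + p2 * Lr xi) * w / 2 - t * d * (Lp eta - Lp xi) =
   generator beta u eta + generator beta v xi.
  by rewrite /u /v !generatorD -/Lr -/Lp; ring.
rewrite generator_coupling// -/xi.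
(* Concavity, multiplied by [w / 2], handles the [rho] part; the [psi] part is an exact computation
   using [w = d ^+ 2]. *)
have tangent a b :
    (T a b * w - t * w) / 2 + t * w - t * d * (psi a - psi b) <= u a + v b - (u eta + v xi).
  have /(ler_wpM2l w0) := concave_tangent_sym theta_weight (rho_gt0 eta) (rho_gt0 xi)
    (rho_gt0 a) (rho_gt0 b).
  rewrite -/p1 -/p2 -/(T a b) -/(T eta xi) -/t /u /v.
  have half : 0 <= 2^-1 :> R by rewrite invr_ge0.
  rewrite -subr_ge0 => /(mulr_ge0 half) h; rewrite -subr_ge0; move: h; congr (0 <= _).
  by rewrite (_ : w = d ^+ 2)// /d; field.
have step a b : 2^-1 * exchange_term T W (eta, xi) (a, b) <= u a + v b - (u eta + v xi).
  apply: le_trans (tangent a b); rewrite /exchange_term/= -/t -/w.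
  (* Half of this square is exactly the gap between the two bounds. *)
  have : 0 <= t * (d - (psi a - psi b)) ^+ 2 by rewrite mulr_ge0// sqr_ge0.
  by rewrite /w /W -/d; lra.
have coalesce a : (T a a + t) * w / 2 <= u a + v a - (u eta + v xi).
  by apply: le_trans (tangent a a); rewrite subrr mulr0; lra.
set k := \sum_(y | e x y && free eta y) 1.
have kD : beta * k <= beta * (max_degree e)%:R.
  rewrite ler_pM2l// /k; have := neighbours_le_max_degree eta x.
  by rewrite -(ler_nat R) natr_sum.
have ins_le : 2^-1 * common_ins T W eta x <=
  \sum_(y | free xi y) (u (ins y eta) + v (ins y xi) - (u eta + v xi)).
  by rewrite mulr_sumr; apply: ler_sum => y _; exact: step.
have del_le : 2^-1 * common_del T W eta x <=
  \sum_(y | eta y) (u (del y eta) + v (del y xi) - (u eta + v xi)).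
  by rewrite mulr_sumr; apply: ler_sum => y _; exact: step.
have swap_le : 2^-1 * swap T W eta x <=
  \sum_(y | e x y && free eta y) (u (ins y eta) + v eta - (u eta + v xi)).
  by rewrite mulr_sumr; apply: ler_sum => y _; exact: step.
move: ins_le swap_le => /(ler_wpM2l (ltW beta_gt0)) ins_le /(ler_wpM2l (ltW beta_gt0)) swap_le.
have {coalesce} coal : K * t * w <=
    beta * (u xi + v xi - (u eta + v xi)) + (1 - beta * k) * (u eta + v eta - (u eta + v xi)).
  have bk0 : 0 <= 1 - beta * k by rewrite subr_ge0 (le_trans kD).
  apply: le_trans (lerD (ler_wpM2l (ltW beta_gt0) (coalesce xi)) (ler_wpM2l bk0 (coalesce eta))).
  have Tge0 c : 0 <= T c c by exact: (theta_ge0 theta_weight).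
  have := M_theta_le theta_weight (rho_gt0 eta) (rho_gt0 xi).
  rewrite -/(T eta xi) -/(T eta eta) -/(T xi xi) -/t => Mt.
  set q := Num.min beta (1 - beta * (max_degree e)%:R) in K *.
  have q0 : 0 <= q by rewrite /q le_min (ltW beta_gt0) subr_ge0.
  have qb : q <= beta by rewrite /q ge_min lexx.
  have qk : q <= 1 - beta * k.
    by apply: (@le_trans _ _ (1 - beta * (max_degree e)%:R));
      [rewrite /q ge_min lexx orbT|rewrite lerD2l lerN2].
  rewrite -subr_ge0.
  (* The two merging rates share the part [q], where [M_theta_le] applies; the surplus rates and the
     gap between [Delta] and [k] leave nonnegative remainders. *)
  have -> : beta * ((T xi xi + t) * w / 2) + (1 - beta * k) * ((T eta eta + t) * w / 2) - K * t * w =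
     w / 2 * ((beta - q) * T xi xi + (1 - beta * k - q) * T eta eta +
       q * (T eta eta + T xi xi - 2 * M_theta theta * t) +
       (beta * (max_degree e)%:R - beta * k) * t).
    by rewrite /K; field.
  rewrite mulr_ge0 ?divr_ge0// !addr_ge0// mulr_ge0// subr_ge0//.
lra.
Qed.
End EdgeInequality.
End ConfigMoves.

(** * Summation of the edge inequalities *)

Theorem theorem4p7 (R : realType) (V : finType) (e : rel V)
    (e_simple : simple_graph e) (e_connected : connected_graph e)
    (Delta : nat) (Delta_max : Delta = max_degree e)
    (beta : R) (beta_gt0 : 0 < beta) (beta_lt1 : beta < 1)
    (beta_Delta : beta * Delta%:R <= 1)
    (kappa kappa_bar : R)
    (kappa_def : kappa = 1 - beta * (Delta%:R - 1))
    (kappa_bar_def : kappa_bar = Num.min beta (1 - beta * Delta%:R))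
    (theta : R -> R -> R) (theta_weight : weight_function theta)
    (rho psi : config e -> R) (rho_gt0 : forall eta, 0 < rho eta) :
  Bfun beta theta rho psi >=
  (kappa / 2 + M_theta theta * kappa_bar) * Afun beta theta rho psi.
Proof.
set K := kappa / 2 + _.
pose L := generator beta (e := e).
pose T c d := theta (rho c) (rho d).
pose W c d := (psi c - psi d) ^+ 2.
have T_sym c d : T c d = T d c by exact: (theta_sym theta_weight).
have W_sym c d : W c d = W d c by rewrite /W -sqrrN opprB.
pose Fa c d := T c d * W c d.
pose Fc c d := (partial1 theta (rho c) (rho d) * L rho c +
  partial2 theta (rho c) (rho d) * L rho d) * W c d.
pose Fd c d := T c d * (psi c - psi d) * (L psi c - L psi d).
have AE : Afun beta theta rho psi = 2^-1 * \sum_(p : config e * move V | 0 < rate beta p.1 p.2)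
    hardcore_measure beta p.1 * rate beta p.1 p.2 * Fa p.1 (apply_move p.2 p.1).
  by congr (_ * _); apply: eq_bigr => p _; rewrite /Fa mulrA.
have CE : Cfun beta theta rho psi = 4^-1 * \sum_(p : config e * move V | 0 < rate beta p.1 p.2)
    hardcore_measure beta p.1 * rate beta p.1 p.2 * Fc p.1 (apply_move p.2 p.1).
  by congr (_ * _); apply: eq_bigr => p _; rewrite /Fc mulrA.
have DE : Dfun beta theta rho psi = 2^-1 * \sum_(p : config e * move V | 0 < rate beta p.1 p.2)
    hardcore_measure beta p.1 * rate beta p.1 p.2 * Fd p.1 (apply_move p.2 p.1).
  by congr (_ * _); apply: eq_bigr => p _; rewrite /Fd !mulrA.
rewrite -subr_ge0 /Bfun AE CE DE !sum_edges// !mulr_sumr -!sumrB.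
have cancel : \sum_x \sum_(eta | free eta x) beta * hardcore_measure beta eta *
    (2^-1 * (beta * common_ins T W eta x + common_del T W eta x) +
     2^-1 * (beta * swap T W eta x)) = 0.
  transitivity (beta / 2 * \sum_x \sum_(eta | free eta x) hardcore_measure beta eta *
      (beta * common_ins T W eta x + common_del T W eta x) +
    beta / 2 * beta * \sum_x \sum_(eta | free eta x) hardcore_measure beta eta * swap T W eta x).
    rewrite !mulr_sumr -big_split/=; apply: eq_bigr => x _.
    by rewrite !mulr_sumr -big_split/=; apply: eq_bigr => eta _; ring.
  by rewrite sum_common// sum_swap// !mulr0 addr0.
(* Writing 0 as the vanishing sum of exchange terms reduces the claim to a comparison edge by
   edge. *)
rewrite -[leLHS]cancel; apply: ler_sum => x _.
rewrite !mulr_sumr -!sumrB; apply: ler_sum => eta fr.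
set xi := ins x eta.
(* [Fa] and [Fd] agree on both orientations, which absorbs their factor 1/2; in [Fc] the
   orientations combine into the averaged partial derivatives. *)
have -> : 4^-1 * (beta * hardcore_measure beta eta * (Fc eta xi + Fc xi eta)) -
    2^-1 * (beta * hardcore_measure beta eta * (Fd eta xi + Fd xi eta)) -
    K * (2^-1 * (beta * hardcore_measure beta eta * (Fa eta xi + Fa xi eta))) =
  beta * hardcore_measure beta eta *
  (((partial1 theta (rho eta) (rho xi) + partial2 theta (rho xi) (rho eta)) / 2 * L rho eta +
    (partial2 theta (rho eta) (rho xi) + partial1 theta (rho xi) (rho eta)) / 2 * L rho xi) *
    W eta xi / 2 -
   T eta xi * (psi eta - psi xi) * (L psi eta - L psi xi) - K * T eta xi * W eta xi).
  by rewrite /Fa /Fc /Fd (T_sym xi) (W_sym xi); field.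
apply: ler_wpM2l; first by rewrite mulr_ge0 ?measure_ge0 ?ltW.
rewrite /K kappa_def kappa_bar_def Delta_max.
by apply: edge_inequality => //; rewrite -Delta_max.
Qed.
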